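(* Let $G$ be a bipartite digraph with partite sets $X$ and $Y$. If $G$ is $4$-free, then $\beta(G)\le \frac{1}{2}\gamma(G)$.
   Context: All digraphs are finite, loopless, and have no parallel edges; opposite edges $(x,y)$ and $(y,x)$ are allowed. A digraph $G$ is bipartite with partite sets $X$ and $Y$ if $V(G)$ is the disjoint union of $X$ and $Y$ and every edge of $G$ has one end in $X$ and the other in $Y$. A directed $k$-cycle is a directed cycle of length $k$ (a pair of opposite edges is a directed $2$-cycle). A digraph is $m$-free if it contains no directed cycle of length at most $m$; it is acyclic if it contains no directed cycle. For a digraph $G$, $\beta(G)$ is the minimum size of a set $S\subseteq E(G)$ such that deleting the edges of $S$ from $G$ yields an acyclic digraph. Two distinct vertices are adjacent if there is an edge between them (in either direction), and nonadjacent otherwise. For a bipartite digraph $G$ with partite sets $X$ and $Y$, $\gamma(G)$ is the number of unordered nonadjacent pairs $\{x,y\}$ with $x\in X$ and $y\in Y$ (pairs inside a partite set are not counted). *)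

(* Defs.v *)
From mathcomp Require Import all_boot all_order all_algebra.

Set Implicit Arguments.
Unset Strict Implicit.
Unset Printing Implicit Defensive.

(* A digraph is given by a finType V of vertices and its edge relation
   e : rel V, where e x y means that (x, y) is an edge.  Parallel edges are thus
   excluded and opposite edges allowed; looplessness is [irreflexive e]. *)

Section Digraph.

Variable V : finType.
Implicit Types (e : rel V) (s : seq V) (X Y : {set V}) (S : {set V * V}).

Definition edges e : {set V * V} := [set p | e p.1 p.2].

(* The cycle s_0 -> s_1 -> ... -> s_(k-1) -> s_0 is represented by its sequence
   of distinct vertices; its length is [size s].  The test on [size s] is needed
   because [cycle e [::]] holds. *)
Definition dicycle e s : bool := [&& 0 < size s, cycle e s & uniq s].

Definition mfree (m : nat) e : Prop :=
  forall s, dicycle e s -> ~~ (size s <= m).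

Definition acyclic e : Prop := forall s, ~~ dicycle e s.

(* Boolean version of [acyclic]: a directed cycle has at most #|V| vertices. *)
Definition acyclicb e : bool :=
  [forall k : 'I_#|V|.+1, forall t : k.-tuple V, ~~ dicycle e t].

Lemma acyclicP e : reflect (acyclic e) (acyclicb e).
Proof.
apply: (iffP 'forall_forallP) => [acy s | acy k t]; last exact: acy.
apply/negP => cyc_s; have /and3P[_ _ uniq_s] := cyc_s.
have lt_s : size s < #|V|.+1 by rewrite ltnS -(card_uniqP uniq_s) max_card.
by have /negP := acy (Ordinal lt_s) (in_tuple s).
Qed.

Definition del_edges e S : rel V := [rel x y | e x y && ((x, y) \notin S)].

Definition acyclifying e S : bool :=
  (S \subset edges e) && acyclicb (del_edges e S).

Lemma acyclifying_edges e : acyclifying e (edges e).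
Proof.
rewrite /acyclifying subxx; apply/acyclicP => -[|x s] //.
apply/negP => /and3P[_ /= + _].
by case: s => [|y s] /= /andP[/andP[exy /negP[]]]; rewrite inE.
Qed.

(* By [acyclifying_edges] the default value [edges e] is admissible, so this is
   a genuine minimum. *)
Definition beta e : nat :=
  #|[arg min_(S < edges e | acyclifying e S) #|S| ]|.

Lemma beta_attained e : exists2 S, acyclifying e S & #|S| = beta e.
Proof.
rewrite /beta; case: arg_minnP => [|S acyS _]; first exact: acyclifying_edges.
by exists S.
Qed.

Lemma beta_le e S : acyclifying e S -> beta e <= #|S|.
Proof.
rewrite /beta; case: arg_minnP => [|T _ minT]; first exact: acyclifying_edges.
exact: minT.
Qed.

Definition bipartite e X Y : Prop :=
  [/\ X :|: Y = [set: V], [disjoint X & Y] &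
      forall x y, e x y -> (x \in X) && (y \in Y) || (x \in Y) && (y \in X)].

Definition nonadjacent e (x y : V) : bool := (x != y) && ~~ (e x y || e y x).

Definition gamma e X Y : nat :=
  #|[set [set x; y] | x in X, y in Y & nonadjacent e x y]|.

End Digraph.

(* Main.v *)
(** For a vertex [v] let [d1, d2] be its sets of out-neighbours and of vertices at
    out-distance two, and [d1', d2'] the same for in-neighbours.  In a 4-free
    bipartite digraph every edge leaving [B = d1 u d2] goes from [d2] to a vertex
    nonadjacent to [v]; once these [leave v] edges are deleted, the rest can be
    ordered as (complement of [B u v]), [v], [B], and one recurses on both parts.
    The same works for [d1' u d2'] in the reversed digraph, at the price of
    [leave' v] edges.  Both cuts are crossed by the nonadjacent pairs in
    [d1' x d2] and in [d2' x d1].  Summing over [v] and reading such a pair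
    (resp. such an edge) as a walk of length 3 with nonadjacent ends shows that
    the total of the crossing pairs equals the total of [leave + leave'].  Hence at
    some [v] one of the two cuts has at least twice as many crossing pairs as
    deleted edges. *)

Require Import Defs.
From mathcomp Require Import all_boot all_order all_algebra.
From mathcomp Require Import zify lra.
Import Order.TTheory GRing.Theory Num.Theory.
Local Open Scope nat_scope.

(** * Reversal, closed 4-walks, walks of length two *)

Definition flip {V : Type} (e : rel V) : rel V := fun x y => e y x.

(** The vertices may repeat, so loops and opposite edges are excluded as well. *)
Definition no_closed4 {V : Type} (e : rel V) : Prop :=
  forall a b x d, e a b -> e b x -> e x d -> e d a = false.

Lemma no_closed4_flip (V : Type) (e : rel V) : no_closed4 e -> no_closed4 (flip e).
Proof.
move=> e4 a b x d eba exb edx; apply/negP => /= ead.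
by have := e4 _ _ _ _ ead edx exb; rewrite [e b a]eba.
Qed.

(** A closed 4-walk with a repeated vertex contains opposite edges; otherwise it is a directed
    4-cycle. *)
Lemma mfree_no_closed4 (V : finType) (e : rel V) :
  irreflexive e -> mfree 4 e -> no_closed4 e.
Proof.
move=> e0 e4 a b x d eab ebx exd; apply/negP => eda.
have neq u w : e u w -> u != w by apply: contraTneq => ->; rewrite e0.
have no2 u w : e u w -> e w u -> False.
  move=> euw ewu; have /e4 // : dicycle e [:: u; w].
  by rewrite /dicycle /= euw ewu inE neq.
have nax : a != x by apply/eqP => ax; apply: (no2 a b) => //; rewrite ax.
have nbd : b != d by apply/eqP => bd; apply: (no2 b x) => //; rewrite bd.
have /e4 // : dicycle e [:: a; b; x; d].
rewrite /dicycle /= eab ebx exd eda !inE !negb_or nax nbd (neq _ _ eab).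
by rewrite (neq _ _ ebx) (neq _ _ exd) eq_sym (neq _ _ eda).
Qed.

(** The middle vertex must lie in [W] because the recursion works in the subdigraph induced on
    [W]. *)
Definition dist2 {V : finType} (W : {set V}) (e : rel V) : rel V :=
  fun x z => [exists y in W, e x y && e y z].

Lemma dist2P (V : finType) (W : {set V}) (e : rel V) x z :
  reflect (exists y, [/\ y \in W, e x y & e y z]) (dist2 W e x z).
Proof.
apply: (iffP exists_inP) => [[y Wy /andP[]] | [y [Wy exy eyz]]]; exists y => //.
exact/andP.
Qed.

Lemma dist2_flip (V : finType) (W : {set V}) (e : rel V) x z :
  dist2 W (flip e) x z = dist2 W e z x.
Proof. by apply: eq_existsb => y; rewrite /flip [e z y && _]andbC. Qed.

(** The bipartition is a colouring [c], which survives both restriction to [W] and reversal. *)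
Definition nonadj {V : finType} (c : pred V) (e : rel V) : rel V :=
  fun x y => [&& c x != c y, ~~ e x y & ~~ e y x].

Lemma nonadjC (V : finType) (c : pred V) (e : rel V) x y :
  nonadj c e x y = nonadj c e y x.
Proof. by rewrite /nonadj eq_sym [~~ e x y && _]andbC. Qed.

Lemma nonadj_flip (V : finType) (c : pred V) (e : rel V) x y :
  nonadj c (flip e) x y = nonadj c e x y.
Proof. by rewrite /nonadj /flip [~~ e y x && _]andbC. Qed.

(** * Counting ordered pairs and backward edges *)

Definition pairs {V : finType} (A B : {set V}) (q : rel V) : nat :=
  \sum_(x in A) \sum_(y in B) q x y.

Lemma pairs_flip (V : finType) (A B : {set V}) (q : rel V) :
  pairs A B q = pairs B A (flip q).
Proof. exact: exchange_big. Qed.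

Lemma leq_pairs (V : finType) (A B A' B' : {set V}) (q q' : rel V) :
  {in A & B, forall x y, q x y -> [/\ x \in A', y \in B' & q' x y]} ->
  pairs A B q <= pairs A' B' q'.
Proof.
move=> sub; rewrite /pairs big_mkcond [leqRHS]big_mkcond; apply: leq_sum => x _.
case: ifP => // Ax; case: ifP => [_ | nA'x].
  rewrite big_mkcond [leqRHS]big_mkcond; apply: leq_sum => y _.
  case: ifP => // By; case qxy: (q x y) => //.
  by have [_ -> ->] := sub x y Ax By qxy.
rewrite big1 // => y By; case qxy: (q x y) => //.
by have [] := sub x y Ax By qxy; rewrite nA'x.
Qed.

Definition backward {V : finType} (W : {set V}) (e o : rel V) : nat :=
  pairs W W (fun x y => e x y && ~~ o x y).

(* The pairs counted on the right are ordered, whence the factor 4 for the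
   bound by half the number of unordered pairs. *)
Definition well_ordered {V : finType} (c : pred V) (e : rel V) (W : {set V}) : Prop :=
  exists o : rel V, [/\ irreflexive o, transitive o &
    4 * backward W e o <= pairs W W (nonadj c e)].

Lemma well_ordered_flip (V : finType) (c : pred V) (e : rel V) (W : {set V}) :
  well_ordered c (flip e) W -> well_ordered c e W.
Proof.
move=> [o [o0 oT le_o]]; exists (flip o); split=> //.
  by move=> y x z oyx ozy; apply: oT ozy oyx.
rewrite /backward pairs_flip.
apply: leq_trans le_o _; apply: leq_pairs => x y Wx Wy.
by rewrite nonadj_flip.
Qed.

(** * Joining two orders along a cut *)

Section Cut.

Variables (V : finType) (c : pred V) (e : rel V) (A B : {set V}) (v : V).
Hypotheses (AB0 : [disjoint A & B]) (nAv : v \notin A) (nBv : v \notin B).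

Let W := A :|: (v |: B).

Lemma sum_cut (F : V -> nat) :
  \sum_(x in W) F x = \sum_(x in A) F x + (F v + \sum_(x in B) F x).
Proof.
rewrite (eq_bigl [in [predU A & v |: B]]) => [|x]; last by rewrite !inE.
rewrite bigU ?big_setU1 //=; apply/pred0P => x /=; rewrite !inE.
case: (eqVneq x v) => [->|_] /=; first by rewrite (negPf nAv).
by apply/negP => /andP[Ax]; rewrite (disjointFr AB0 Ax).
Qed.

Lemma pairs_cut (q : rel V) : pairs W W q =
  pairs A A q + pairs B B q + pairs A B q + pairs B A q
  + (\sum_(x in A) q x v + \sum_(x in A) q v x
     + \sum_(x in B) q x v + \sum_(x in B) q v x + q v v).
Proof.
rewrite /pairs sum_cut !sum_cut.
under eq_bigr do rewrite sum_cut.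
under [X in _ + (_ + X) = _]eq_bigr do rewrite sum_cut.
rewrite !big_split /=; lia.
Qed.

(** In the order [A], [v], [B], with [oA] and [oB] inside the parts, the only new backward edges go
    from [B] to [A]. *)
Lemma well_ordered_cut :
    well_ordered c e A -> well_ordered c e B ->
    e v v = false -> {in A, forall x, e v x = false} ->
    {in B, forall x, e x v = false} ->
    2 * pairs B A e <= pairs B A (nonadj c e) ->
  well_ordered c e W.
Proof.
move=> [oA [oA0 oAT leA]] [oB [oB0 oBT leB]] evv evA eBv le_cut.
pose l x := if x \in A then 0 else if x \in B then 2 else 1.
pose o x y := [|| l x < l y, [&& x \in A, y \in A & oA x y]
                | [&& x \in B, y \in B & oB x y]].
have BF x : x \in A -> (x \in B) = false by move/(disjointFr AB0).
have lv : l v = 1 by rewrite /l (negPf nAv) (negPf nBv).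
exists o; split=> [x | y x z |].
- by rewrite /o ltnn oA0 oB0 !andbF.
- rewrite /o /l.
  case Ax: (x \in A); case Ay: (y \in A); case Az: (z \in A);
    rewrite ?(BF _ Ax) ?(BF _ Ay) ?(BF _ Az) //=; rewrite ?orbF;
    first [exact: oAT | idtac];
    case: (x \in B); case: (y \in B); case: (z \in B) => //=; exact: oBT.
rewrite /backward [leqRHS]pairs_cut pairs_cut.
set q : rel V := fun x y => _.
have qA : pairs A A q <= backward A e oA.
  apply: leq_pairs => x y Ax Ay; rewrite /q /o Ax Ay.
  by case/andP=> -> /= /norP[_ /norP[]].
have qB : pairs B B q <= backward B e oB.
  apply: leq_pairs => x y Bx By; rewrite /q /o Bx By.
  by case/andP=> -> /= /norP[_ /norP[]].
have qAB : pairs A B q = 0.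
  rewrite /pairs big1 // => x Ax; rewrite big1 // => y By.
  by rewrite /q /o /l Ax By (disjointFl AB0 By) andbF.
have qBA : pairs B A q <= pairs B A e.
  by apply: leq_pairs => x y Bx Ay /andP[].
have -> : \sum_(x in A) q x v = 0.
  by rewrite big1 // => x Ax; rewrite /q /o lv /l Ax andbF.
have -> : \sum_(x in A) q v x = 0.
  by rewrite big1 // => x Ax; rewrite /q evA.
have -> : \sum_(x in B) q x v = 0.
  by rewrite big1 // => x Bx; rewrite /q eBv.
have -> : \sum_(x in B) q v x = 0.
  by rewrite big1 // => x Bx; rewrite /q /o lv /l (disjointFl AB0 Bx) Bx andbF.
rewrite evv /=.
(* Counting each crossing pair in both orders turns the factor 2 of [le_cut] into 4. *)
have NAB : pairs A B (nonadj c e) = pairs B A (nonadj c e).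
  by rewrite pairs_flip; apply: eq_bigr => x _; apply: eq_bigr => y _;
     rewrite /flip nonadjC.
lia.
Qed.

End Cut.

(** * Walks of length 3 with nonadjacent ends *)

Definition leave {V : finType} (c : pred V) (e : rel V) (W : {set V}) (v : V) : nat :=
  pairs W W (fun x y => [&& dist2 W e v x, e x y & nonadj c e v y]).

(** The ends of a walk of length 3 with second vertex [v]; in [cross21] the third vertex is [v], in
    [leave] the first. *)
Definition cross12 {V : finType} (c : pred V) (e : rel V) (W : {set V}) (v : V) : nat :=
  pairs W W (fun b x => [&& e b v, dist2 W e v x & nonadj c e b x]).

Definition cross21 {V : finType} (c : pred V) (e : rel V) (W : {set V}) (v : V) : nat :=
  pairs W W (fun b a => [&& dist2 W e b v, e v a & nonadj c e b a]).

Section Walks.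

Variables (V : finType) (c : pred V).
Implicit Types (e : rel V) (W : {set V}).

(** Both sides count triples of first, third and last vertex of such walks, grouped by the third on
    the left and by the first on the right. *)
Lemma sum_cross21 e W : \sum_(v in W) cross21 c e W v = \sum_(v in W) leave c e W v.
Proof. exact: exchange_big. Qed.

Lemma cross12_flip e W v : cross12 c (flip e) W v = cross21 c e W v.
Proof.
rewrite /cross12 /cross21 pairs_flip; apply: eq_bigr => x _; apply: eq_bigr => y _.
by rewrite /flip -/(flip e) dist2_flip nonadj_flip nonadjC andbCA.
Qed.

Lemma cross21_flip e W v : cross21 c (flip e) W v = cross12 c e W v.
Proof. by rewrite -cross12_flip. Qed.

(** Averaging: the totals over [W] agree, so at some [v] the two [leave] counts sum to at most the
    number of crossing pairs, and the smaller one is at most half of it. *)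
Lemma exists_good_vertex e W : W != set0 ->
  exists2 v, v \in W &
    2 * leave c e W v <= cross12 c e W v + cross21 c e W v
    \/ 2 * leave c (flip e) W v <= cross12 c e W v + cross21 c e W v.
Proof.
case/set0Pn=> v0 Wv0.
have [/exists_inP[v Wv le_v] | /exists_inPn none] :=
  boolP [exists v in W, leave c e W v + leave c (flip e) W v
                        <= cross12 c e W v + cross21 c e W v].
  by exists v => //; lia.
suff: \sum_(v in W) (cross12 c e W v + cross21 c e W v)
      < \sum_(v in W) (leave c e W v + leave c (flip e) W v).
  rewrite !big_split /= sum_cross21 -(sum_cross21 (flip e)).
  by under [X in _ < _ + X]eq_bigr do rewrite cross21_flip; rewrite addnC ltnn.
rewrite (bigD1 v0) //= [ltnRHS](bigD1 v0) //= -addSn; apply: leq_add.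
  by rewrite ltnNge none.
by apply: leq_sum => v /andP[Wv _]; rewrite ltnW // ltnNge none.
Qed.

(** * The recursion on vertex subsets *)

Lemma well_ordered_step e W v :
    (forall x y, e x y -> c x != c y) -> no_closed4 e -> v \in W ->
    2 * leave c e W v <= cross12 c e W v + cross21 c e W v ->
    (forall W', #|W'| < #|W| -> well_ordered c e W') ->
  well_ordered c e W.
Proof.
move=> ec e4 Wv le_v IH.
have e2 x y : e x y -> e y x = false.
  by move=> exy; apply/negP => eyx; have := e4 _ _ _ _ exy eyx exy; rewrite eyx.
have cF x y : e x y -> c y = ~~ c x.
  by move/ec; case: (c x); case: (c y).
have d2c x y : dist2 W e x y -> c y = c x.
  by case/dist2P=> z [_ /cF cz /cF ->]; rewrite cz negbK.
have d2F x y : c y != c x -> dist2 W e x y = false.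
  by apply: contraNF => /d2c ->.
have evv : e v v = false by apply/negP => evv; have := e2 _ _ evv; rewrite evv.
have dvv : dist2 W e v v = false.
  by apply/dist2P => -[z [_ /e2 evz ezv]]; rewrite evz in ezv.
pose B := [set x in W | e v x || dist2 W e v x].
pose A := [set x in W | (x != v) && ~~ (e v x || dist2 W e v x)].
have AB0 : [disjoint A & B].
  by apply/pred0P => x /=; rewrite !inE; case: (_ || _); rewrite !(andbT, andbF).
have nAv : v \notin A by rewrite !inE eqxx andbF.
have nBv : v \notin B by rewrite !inE evv dvv andbF.
have eW : W = A :|: (v |: B).
  apply/setP => x; rewrite !inE.
  by case: eqVneq => [->|_] /=; rewrite ?Wv ?orbT //; case: (x \in W) => //=;
     rewrite orNb.
rewrite eW; apply: well_ordered_cut => //.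
- apply: IH; apply: proper_card; apply/properP; split; last by exists v.
  by apply/subsetP => x; rewrite inE => /andP[].
- apply: IH; apply: proper_card; apply/properP; split; last by exists v.
  by apply/subsetP => x; rewrite inE => /andP[].
- by move=> x; rewrite inE => /and3P[_ _ /norP[/negPf]].
(* From out-distance two, an edge into [v] would join vertices of the same colour. *)
- move=> x; rewrite inE => /andP[_ /orP[/e2 //|/dist2P[y [_ evy eyx]]]].
  apply/negP => exv.
  by have := cF _ _ evy; rewrite (cF _ _ exv) (cF _ _ eyx) negbK; case: (c y).
(* If [x] were an out-neighbour of [v], then [y] would be in [B]; so [x] is at out-distance two, and
   an edge from [y] to [v] would close a 4-walk. *)
have le_leave : pairs B A e <= leave c e W v.
  apply: leq_pairs => x y; rewrite !inE.
  case/andP=> Wx dx /and3P[Wy yv /norP[nevy ndvy]] exy; split=> //.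
  have dvx : dist2 W e v x.
    case/orP: dx => // evx; case/negP: ndvy; apply/dist2P; by exists x.
  rewrite dvx exy /nonadj nevy (cF _ _ exy) (d2c _ _ dvx) /=.
  have [a [_ eva eax]] := dist2P _ _ _ _ _ dvx.
  by rewrite (e4 _ _ _ _ eva eax exy); case: (c v).
(* The colour of [b] decides which of the two counts a pair can enter, so none is counted twice; it
   remains to see that [b] is in [A]. *)
have le_cross : cross12 c e W v + cross21 c e W v <= pairs B A (nonadj c e).
  have -> : pairs B A (nonadj c e) =
      pairs W W (fun b x => [&& b \in A, x \in B & nonadj c e b x]).
    apply/eqP; rewrite pairs_flip eqn_leq; apply/andP; split;
      apply: leq_pairs => x y.
      move=> Ax By; rewrite /flip nonadjC Ax By => ->; split=> //.
        by move: Ax; rewrite inE => /andP[].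
      by move: By; rewrite inE => /andP[].
    by move=> _ _ /and3P[? ? ?]; rewrite /flip nonadjC.
  rewrite /cross12 /cross21 /pairs -big_split; apply: leq_sum => b Wb /=.
  rewrite -big_split; apply: leq_sum => x Wx /=; rewrite !inE Wb Wx /=.
  case N: (nonadj c e b x); rewrite ?andbT ?andbF //.
  have [ebv | nebv] /= := boolP (e b v).
    have -> : dist2 W e b v = false.
      by apply: d2F; rewrite (cF _ _ ebv); case: (c b).
    rewrite (e2 _ _ ebv) /= addn0; case: (dist2 W e v x) => //=.
    have -> : b != v by apply: contraTneq ebv => ->; rewrite evv.
    have -> : dist2 W e v b = false.
      by apply: d2F; rewrite (cF _ _ ebv); case: (c b).
    by rewrite orbT.
  rewrite add0n; have [dbv /= | //] := boolP (dist2 W e b v).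
  case: (e v x) => //=.
  have -> : b != v by apply: contraTneq dbv => ->; rewrite dvv.
  have -> : e v b = false.
    by apply/negP => evb; have := cF _ _ evb;
       rewrite (d2c _ _ dbv); case: (c b).
  have -> // : dist2 W e v b = false.
  (* Walks of length two from [v] to [b] and back form a closed 4-walk. *)
  apply/dist2P => -[y [_ evy eyb]]; have [z [_ ebz ezv]] := dist2P _ _ _ _ _ dbv.
  by have := e4 _ _ _ _ evy eyb ebz; rewrite ezv.
lia.
Qed.

Lemma well_ordered_all e W :
  (forall x y, e x y -> c x != c y) -> no_closed4 e -> well_ordered c e W.
Proof.
move=> ec e4; move: {2}#|W|.+1 (ltnSn #|W|) => n.
elim: n W => // n IHn W; rewrite ltnS => le_n.
have IH W' : #|W'| < #|W| -> well_ordered c e W'.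
  by move=> lt_W'; apply: IHn; apply: leq_trans lt_W' le_n.
have [-> | /(exists_good_vertex e)[v Wv [] le_v]] := eqVneq W set0.
- exists (fun _ _ => false); split=> //.
  by rewrite /backward /pairs !big_set0.
- exact: well_ordered_step le_v IH.
(* The second alternative is the first for the reversed digraph, where the two crossing counts
   swap. *)
apply: well_ordered_flip; apply: well_ordered_step Wv _ _.
- by move=> x y /ec; rewrite eq_sym.
- exact: no_closed4_flip.
- by rewrite cross12_flip cross21_flip addnC.
- by move=> W' /IH woW'; apply: (@well_ordered_flip _ c (flip e)).
Qed.

End Walks.

(** * From orders to [beta] and [gamma] *)

Lemma order_acyclic (V : finType) (o : rel V) :
  irreflexive o -> transitive o -> acyclic o.
Proof.
move=> o0 oT [|x s] //; apply/negP => /and3P[_ /= + _].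
move/(order_path_min oT)/allP/(_ x); rewrite mem_rcons inE eqxx o0.
by move=> /(_ isT).
Qed.

Lemma beta_le_backward (V : finType) (e o : rel V) :
  irreflexive o -> transitive o -> beta e <= backward [set: V] e o.
Proof.
move=> o0 oT; pose S := [set p | e p.1 p.2 && ~~ o p.1 p.2].
have -> : backward [set: V] e o = #|S|.
  rewrite /backward /pairs pair_big /= -sum1_card big_mkcond [RHS]big_mkcond /=.
  by apply: eq_bigr => p _; rewrite !inE /=; case: (_ && _).
apply: beta_le; apply/andP; split.
  by apply/subsetP => p; rewrite !inE => /andP[].
apply/acyclicP => s; apply: contra (order_acyclic _ _ o0 oT s).
case/and3P=> s0 cyc_s Us; apply/and3P; split=> //.
apply: sub_cycle cyc_s => x y /andP[exy]; rewrite inE exy /=.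
by rewrite negbK.
Qed.

Lemma pairs_nonadj_gamma (V : finType) (e : rel V) (X Y : {set V}) :
  bipartite e X Y ->
  pairs [set: V] [set: V] (nonadj [in X] e) <= 2 * gamma e X Y.
Proof.
case=> XYT XY0 _.
have Yx x : (x \in Y) = (x \notin X).
  have /setP/(_ x) := XYT; rewrite !inE.
  by case Xx: (x \in X); [rewrite (disjointFr XY0 Xx) | ].
(* [N] keeps one order of each nonadjacent pair, from [X] to [Y]. *)
pose N : rel V := fun x y => [&& x \in X, y \in Y & nonadjacent e x y].
have -> : pairs [set: V] [set: V] (nonadj [in X] e)
          = 2 * pairs [set: V] [set: V] N.
  rewrite mul2n -addnn [X in _ + X]pairs_flip /pairs -big_split.
  apply: eq_bigr => x _.
  rewrite -big_split; apply: eq_bigr => y _ /=.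
  rewrite /flip /N /nonadj /nonadjacent !Yx /= negb_or [y == x]eq_sym.
  rewrite [e y x || _]orbC negb_or.
  case: (eqVneq x y) => [->|_]; first by rewrite eqxx !andbF.
  by case: (x \in X); case: (y \in X); rewrite /= ?addn0.
rewrite leq_pmul2l //.
pose S := [set p | N p.1 p.2].
have -> : pairs [set: V] [set: V] N = #|S|.
  rewrite /pairs pair_big /= -sum1_card big_mkcond [RHS]big_mkcond /=.
  by apply: eq_bigr => p _; rewrite !inE /=; case: (N _ _).
have inj : {in S &, injective (fun p : V * V => [set p.1; p.2])}.
  move=> [x y] [x' y']; rewrite !inE /= => /and3P[Xx Yy _] /and3P[Xx' Yy' _] eqs.
  have /setP/(_ x) := eqs; rewrite !inE eqxx /=.
  have -> : (x == y') = false.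
    by apply: contraTF Xx => /eqP->; rewrite -Yx.
  rewrite orbF => /esym/eqP <-.
  have /setP/(_ y) := eqs; rewrite !inE eqxx orbT.
  have -> : (y == x') = false.
    by apply: contraTF Xx' => /eqP<-; rewrite -Yx.
  by move/esym/eqP=> /= ->.
rewrite -(card_in_imset inj); apply: subset_leq_card; apply/subsetP => s.
case/imsetP=> -[x y]; rewrite inE /= => /and3P[Xx Yy Nxy] ->.
by apply/imset2P; exists x y => //; rewrite inE Yy.
Qed.

Local Open Scope ring_scope.

Theorem theorem1p3 (V : finType) (e : rel V) (X Y : {set V})
  (e_loopless : irreflexive e)
  (e_bipartite : bipartite e X Y)
  (e_4free : mfree 4 e) :
  (beta e)%:R <= 1 / 2 * (gamma e X Y)%:R :> rat.
Proof.
have [_ XY0 eXY] := e_bipartite.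
have eX x y : e x y -> [in X] x != [in X] y.
  by case/eXY/orP => /andP[/= Hx Hy]; rewrite ?Hx ?Hy ?(disjointFl XY0 Hx)
    ?(disjointFl XY0 Hy).
have e4 := mfree_no_closed4 _ _ e_loopless e_4free.
have [o [o0 oT le_o]] := well_ordered_all _ _ _ [set: V] eX e4.
have le_b := beta_le_backward _ e _ o0 oT.
have le_g := pairs_nonadj_gamma _ _ _ _ e_bipartite.
(* The chained bounds give [4 * beta <= 2 * gamma]. *)
have : (2 * beta e <= gamma e X Y)%N by lia.
rewrite -(ler_nat rat) natrM; lra.
Qed.
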